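(* Suppose that $x^*$ is a local minimizer of the problem $$\min\ f(x)+p(x)-u(x)\quad\text{s.t.}\quad g_i(x)+q_i(x)-v_i(x)\le 0,\ i=1,\ldots,m,\quad x\in\mathcal X. \qquad (P)$$ Let $\mathcal A(x^* )=\{1\le i\le m:\ g_i(x^* )+q_i(x^* )-v_i(x^* )=0\}$ and $$\mathcal A_{\mathcal T}(x^* )=\{i\in\mathcal A(x^* ):\ g_i'(x^*;d)+q_i'(x^*;d)-v_i'(x^*;d)=0\ \text{for some } 0\ne d\in\mathcal T_{\mathcal X}(x^* )\}.$$ Assume that the cone $$\sum_{i\in\mathcal A(x^* )}\mathrm{cone}\big(\nabla g_i(x^* )+\partial q_i(x^* )-\partial v_i(x^* )\big)+\mathcal N_{\mathcal X}(x^* )$$ is closed, and moreover that there exists $\bar d\in\mathcal T_{\mathcal X}(x^* )$ such that $$g_i'(x^*;\bar d)+q_i'(x^*;\bar d)-\inf_{s\in\partial v_i(x^* )}s^T\bar d<0\qquad\forall i\in\mathcal A_{\mathcal T}(x^* ).$$ Then there exists $\lambda^*\in\mathbb R^m$ which together with $x^*$ satisfies the KKT conditions $$0\in\nabla f(x^* )+\partial p(x^* )-\partial u(x^* )+\sum_{i=1}^m\lambda_i^*\,[\nabla g_i(x^* )+\partial q_i(x^* )-\partial v_i(x^* )]+\mathcal N_{\mathcal X}(x^* ),$$ $$\lambda_i^*\ge 0,\qquad \lambda_i^*\,[g_i(x^* )+q_i(x^* )-v_i(x^* )]=0,\qquad i=1,\ldots,m.$$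
   Context: Setting: $\mathcal X\subseteq\mathbb R^n$ is a nonempty closed convex set and $U$ is an open convex set containing $\mathcal X$. The functions $f,g_1,\ldots,g_m:U\to\mathbb R$ are differentiable at every point of $\mathcal X$. The functions $p,u,q_1,\ldots,q_m,v_1,\ldots,v_m:U\to\mathbb R$ are convex (not necessarily smooth). Standing assumption: there are constants $L_f\ge0$, $L_{g_i}\ge0$ with $\|\nabla f(x)-\nabla f(y)\|\le L_f\|x-y\|$ and $\|\nabla g_i(x)-\nabla g_i(y)\|\le L_{g_i}\|x-y\|$ for all $x,y\in\mathcal X$, $i=1,\ldots,m$. Notation: $h'(x;d)$ is the directional derivative of $h$ at $x$ along $d$; $\partial h(x)$ is the convex subdifferential of a convex function $h$ at $x$; $\mathrm{cone}(\Omega)=\{t\omega:t\ge0,\ \omega\in\Omega\}$ is the cone generated by a nonempty convex set $\Omega$; $\mathcal N_{\mathcal X}(x)$ and $\mathcal T_{\mathcal X}(x)$ are the normal and tangent cones of the convex set $\mathcal X$ at $x\in\mathcal X$. Sums, differences and scalar multiples of sets are in the Minkowski sense, with $S-T=\{s-t:s\in S,t\in T\}$; an empty sum of cones is $\{0\}$. A local minimizer is a feasible point minimizing the objective among feasible points in some neighborhood of it. *)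

(* Defs.v *)
(* The space R^n is the type 'rV[R]_n of row vectors.  Its
   canonical topology comes from the max norm, hence is the Euclidean one; only
   quantitative statements need the Euclidean norm [enorm] below.  A function
   U -> R is represented by a total function 'rV[R]_n -> R whose values outside
   the open set U are irrelevant. *)
From HB Require Import structures.
From mathcomp Require Import all_boot all_order all_algebra.
From mathcomp Require Import all_classical all_reals all_analysis.
Import Order.TTheory GRing.Theory Num.Theory.
Import numFieldNormedType.Exports.

Set Implicit Arguments.
Unset Strict Implicit.
Unset Printing Implicit Defensive.

Local Open Scope classical_set_scope.
Local Open Scope ring_scope.

Section euclidean.
Context {R : realType} {n : nat}.
Implicit Types (x y d s : 'rV[R]_n) (h : 'rV[R]_n -> R).

Definition dot s d : R := \sum_(i < n) s 0 i * d 0 i.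

Definition enorm x : R := Num.sqrt (dot x x).

Definition gradient h x : 'rV[R]_n := \row_(i < n) 'D_(delta_mx 0 i) h x.

(* The library's 'D_d h x is a two-sided limit, which need not exist for a
   nonsmooth convex function; the directional derivative is one-sided. *)
Definition dir_deriv h x d : R :=
  lim ((t^-1 * (h (x + t *: d) - h x)) @[t --> 0^'+]).

End euclidean.

Section set_operations.
Context {R : realType} {n : nat}.
Implicit Types S T : set 'rV[R]_n.

Definition mink_add S T : set 'rV[R]_n := [set s + t | s in S & t in T].

Definition mink_sub S T : set 'rV[R]_n := [set s - t | s in S & t in T].

Definition mink_scale (a : R) S : set 'rV[R]_n := [set a *: s | s in S].

Definition cone S : set 'rV[R]_n :=
  [set t *: w | t in [set t : R | 0 <= t] & w in S].

End set_operations.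

Section convex_analysis.
Context {R : realType} {n : nat}.
Implicit Types (U X : set 'rV[R]_n) (h : 'rV[R]_n -> R) (x : 'rV[R]_n).

Definition subdiff U h x : set 'rV[R]_n :=
  [set s | forall y, U y -> h x + dot s (y - x) <= h y].

Definition normal_cone X x : set 'rV[R]_n :=
  [set s | forall y, X y -> dot s (y - x) <= 0].

(* Bouligand's tangent (contingent) cone; for convex X it is the closure of the
   cone of feasible directions. *)
Definition tangent_cone X x : set 'rV[R]_n :=
  [set d | exists (y : nat -> 'rV[R]_n) (t : nat -> R),
    [/\ forall k, X (y k), forall k, 0 < t k,
        y k @[k --> \oo] --> x, t k @[k --> \oo] --> 0 &
        (t k)^-1 *: (y k - x) @[k --> \oo] --> d]].

Definition lipschitz_gradient X h :=
  exists2 L : R, 0 <= L &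
    forall x y, X x -> X y ->
      enorm (gradient h x - gradient h y) <= L * enorm (x - y).

Definition local_minimizer (C : set 'rV[R]_n) h x :=
  C x /\ \forall y \near x, C y -> h x <= h y.

End convex_analysis.

Declare Scope mink_scope.
Delimit Scope mink_scope with mink.
Notation "S + T" := (mink_add S T) : mink_scope.
Notation "S - T" := (mink_sub S T) : mink_scope.
Notation "a *: S" := (mink_scale a%R S) : mink_scope.
Notation "\sum_ ( i 'in' A ) F" :=
  (\big[mink_add/[set 0%R]]_(i | i \in A) F%mink) : mink_scope.
Notation "\sum_ ( i < m ) F" :=
  (\big[mink_add/[set 0%R]]_(i < m) F%mink) : mink_scope.

Section dc_program.
Context {R : realType} {n m : nat}.
Variables (U X : set 'rV[R]_n).
Variables (g q v : 'I_m -> 'rV[R]_n -> R).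

Definition feasible : set 'rV[R]_n :=
  [set x | X x /\ forall i, g i x + q i x - v i x <= 0].

Definition active (x : 'rV[R]_n) : set 'I_m :=
  [set i | g i x + q i x - v i x = 0].

Definition active_tangent (x : 'rV[R]_n) : set 'I_m :=
  [set i | active x i /\
    exists d, [/\ d != 0, tangent_cone X x d &
      dir_deriv (g i) x d + dir_deriv (q i) x d - dir_deriv (v i) x d = 0]].

Definition constraint_subdiff (i : 'I_m) (x : 'rV[R]_n) : set 'rV[R]_n :=
  ([set gradient (g i) x] + subdiff U (q i) x - subdiff U (v i) x)%mink.

End dc_program.

(* Main.v *)
Require Import Defs.
From mathcomp Require Import all_boot all_order all_algebra.
From mathcomp Require Import all_classical all_reals all_analysis.
From mathcomp Require Import ring lra.
Import Order.TTheory GRing.Theory Num.Theory.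
Import numFieldNormedType.Exports.

(** Why the theorem holds.  Write A for the convex set grad f + dp - du and K
    for the closed convex cone whose closedness is assumed, everything taken at
    x*.  A decomposition of 0 as an element of A + K is exactly a KKT point: an
    element of the cone generated by C_i = grad g_i + dq_i - dv_i is t *: c with
    c in C_i, and t is the multiplier, while inactive constraints receive the
    multiplier 0 ([mink_sum_cone_multipliers]).

    Suppose 0 is not in A + K.  As A is compact and K closed, A + K is closed
    and convex, and separating 0 from it yields a direction d <> 0 along which A
    is negative and K nonpositive ([alternative_compact_cone]).  Nonpositivity
    on the normal cone makes d tangent to X ([polar_tangent_cone]).  A convex
    function has, for each direction, a subgradient realizing its directional
    derivative ([subdiff_dir_deriv]), so the sign conditions on A and on the
    sets C_i become conditions on directional derivatives: the objective strictly
    decreases along d and no active constraint increases to first order.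

    An active constraint whose derivative along d vanishes lies in the set on
    which the constraint qualification gives a direction dbar of strict decrease,
    d itself being the required nonzero tangent vector.  Hence d + e *: dbar, for
    small e > 0, is tangent to X and strictly decreases the objective and all
    active constraints.

    To treat all functions alike, each concave term -v is replaced by the affine
    majorant given by one subgradient of v, which for the constraints is chosen
    so that it is exact along d.  What is left is differentiable plus convex plus
    affine, and such a function has an upper first-order estimate that is uniform
    over directions close to the given one ([upper_slope]).  This uniformity is
    what allows one to follow the curved sequence in X provided by the tangent
    cone; far along it the points are feasible and better than x*, contradicting
    local minimality ([no_feasible_descent]). *)

Set Implicit Arguments.
Unset Strict Implicit.
Unset Printing Implicit Defensive.

Local Open Scope classical_set_scope.
Local Open Scope ring_scope.

(** * The inner product on row vectors *)

Section inner_product.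
Context {R : realType} {n : nat}.
Implicit Types (x y z : 'rV[R]_n) (a : R).

Lemma dotC x y : dot x y = dot y x.
Proof. by apply: eq_bigr => i _; rewrite mulrC. Qed.

Lemma dotDl x y z : dot (x + y) z = dot x z + dot y z.
Proof. by rewrite -big_split; apply: eq_bigr => i _; rewrite mxE mulrDl. Qed.

Lemma dotDr x y z : dot z (x + y) = dot z x + dot z y.
Proof. by rewrite !(dotC z) dotDl. Qed.

Lemma dotZl a x y : dot (a *: x) y = a * dot x y.
Proof. by rewrite mulr_sumr; apply: eq_bigr => i _; rewrite mxE mulrA. Qed.

Lemma dotZr a x y : dot x (a *: y) = a * dot x y.
Proof. by rewrite !(dotC x) dotZl. Qed.

Lemma dotNl x y : dot (- x) y = - dot x y.
Proof. by rewrite -scaleN1r dotZl mulN1r. Qed.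

Lemma dotNr x y : dot x (- y) = - dot x y.
Proof. by rewrite !(dotC x) dotNl. Qed.

Lemma dotBl x y z : dot (x - y) z = dot x z - dot y z.
Proof. by rewrite dotDl dotNl. Qed.

Lemma dotBr x y z : dot z (x - y) = dot z x - dot z y.
Proof. by rewrite dotDr dotNr. Qed.

Lemma dot0l x : dot 0 x = 0.
Proof. by rewrite -(scale0r 0) dotZl mul0r. Qed.

Lemma dot0r x : dot x 0 = 0.
Proof. by rewrite dotC dot0l. Qed.

Lemma dot_sqrD x y a :
  dot (x + a *: y) (x + a *: y) = dot x x + 2 * a * dot x y + a ^+ 2 * dot y y.
Proof. by rewrite dotDl !dotDr !dotZl !dotZr (dotC y x); ring. Qed.

Lemma dot_ge0 x : 0 <= dot x x.
Proof. by apply: sumr_ge0 => i _; rewrite -expr2 sqr_ge0. Qed.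

Lemma dot_eq0 x : dot x x = 0 -> x = 0.
Proof.
move=> /psumr_eq0P x0; apply/rowP => i; rewrite mxE.
by apply/eqP; rewrite -sqrf_eq0 expr2 x0// => j _; rewrite -expr2 sqr_ge0.
Qed.

Lemma dot_gt0 x : x != 0 -> 0 < dot x x.
Proof.
by move=> x0; rewrite lt0r dot_ge0 andbT; apply: contra_neq x0 => /dot_eq0.
Qed.

Lemma dot_delta x i : dot x (delta_mx 0 i) = x 0 i.
Proof.
rewrite /dot (bigD1 i)//= mxE !eqxx mulr1 big1 ?addr0// => j ji.
by rewrite mxE (negPf ji) andbF mulr0.
Qed.

Lemma row_sum_coord x : x = \sum_i x 0 i *: delta_mx 0 i.
Proof. by rewrite [LHS]row_sum_delta. Qed.

Lemma coord_le_norm x i : `|x 0 i| <= `|x|.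
Proof.
rewrite [leRHS](mx_normrE x); apply: (@le_bigmax_cond _ _ _ _ (0, i)).
by [].
Qed.

Lemma norm_le_coord x a : 0 <= a -> (forall i, `|x 0 i| <= a) -> `|x| <= a.
Proof.
move=> a0 xa; rewrite [leLHS](mx_normrE x); apply: bigmax_le => //.
by move=> [i j] _/=; rewrite (ord1 i).
Qed.

(** Compares the max norm, which carries the topology, with the Euclidean one;
    it turns bounds on [dot] into bounded sets. *)
Lemma sqr_norm_le_dot x : `|x| ^+ 2 <= dot x x.
Proof.
have d0 := dot_ge0 x.
rewrite -[leRHS]sqr_sqrtr// ler_sqr ?nnegrE ?sqrtr_ge0//.
apply: norm_le_coord; first exact: sqrtr_ge0.
move=> i; rewrite -sqrtr_sqr ler_sqrt// /dot (bigD1 i)//= -expr2 lerDl.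
by apply: sumr_ge0 => j _; rewrite -expr2 sqr_ge0.
Qed.

Lemma cvg_dot (T : Type) (F : set_system T) {FF : Filter F}
    (f g : T -> 'rV[R]_n) x y :
  f t @[t --> F] --> x -> g t @[t --> F] --> y ->
  dot (f t) (g t) @[t --> F] --> dot x y.
Proof.
move=> fx gy; rewrite /dot.
elim: (index_enum _) => [|i r IH].
  under eq_fun do rewrite big_nil.
  by rewrite big_nil; exact: cvg_cst.
under eq_fun do rewrite big_cons.
rewrite big_cons; apply: cvgD IH; apply: cvgM.
  exact: cvg_comp fx (@coord_continuous R 1 n 0 i x).
exact: cvg_comp gy (@coord_continuous R 1 n 0 i y).
Qed.

Lemma closed_halfspace x a : closed [set y | dot x y <= a].
Proof.
apply: (@preimage_closed _ _ (dot x) [set t | t <= a]); last exact: closed_le.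
move=> y _; apply: (@cvg_dot _ (nbhs y) _ (cst x) id); last exact: cvg_id.
exact: cvg_cst.
Qed.

End inner_product.

(** * Separation in finite dimension *)

Section convexity.
Context {R : realType} {n : nat}.
Implicit Types (A B K U : set 'rV[R]_n) (h : 'rV[R]_n -> R) (x y z d : 'rV[R]_n).
Implicit Types (t e : R).

Lemma convex_setP A : convex_set A <->
  forall x y t, A x -> A y -> 0 <= t -> t <= 1 -> A (t *: x + (1 - t) *: y).
Proof.
split=> [cA x y t Ax Ay t0 t1|cA x y t].
  by have := cA x y (Itv01 t0 t1); rewrite !inE; apply.
rewrite !inE => Ax Ay; apply: cA => //.
Qed.

Lemma convex_functionP U h : convex_function U h ->
  forall x y t, U x -> U y -> 0 <= t -> t <= 1 ->
    h (t *: x + (1 - t) *: y) <= t * h x + (1 - t) * h y.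
Proof.
move=> ch x y t Ux Uy t0 t1.
by have := ch (Itv01 t0 t1) x y; rewrite !inE; apply.
Qed.

Lemma closureP A x :
  closure A x <-> forall e, 0 < e -> exists2 y, A y & `|x - y| < e.
Proof.
split=> [clA e e0|clA V].
  have [y [Ay xy]] := clA _ (nbhsx_ballx x e e0).
  by exists y => //; move: xy; rewrite -ball_normE.
move=> /nbhs_ballP[e /= e0 xV]; have [y Ay xy] := clA e e0.
by exists y; split=> //; apply: xV; rewrite -ball_normE.
Qed.

Lemma convex_set_closure A : convex_set A -> convex_set (closure A).
Proof.
move=> /convex_setP cA; apply/convex_setP => x y t /closureP Ax /closureP Ay.
move=> t0 t1; apply/closureP => e e0.
have [x' Ax' xx'] := Ax e e0; have [y' Ay' yy'] := Ay e e0.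
exists (t *: x' + (1 - t) *: y'); first exact: cA.
have -> : t *: x + (1 - t) *: y - (t *: x' + (1 - t) *: y') =
    t *: (x - x') + (1 - t) *: (y - y').
  by apply/rowP => i; rewrite !mxE; ring.
apply: le_lt_trans (ler_normD _ _) _; rewrite !normrZ.
have s0 : 0 <= 1 - t by rewrite subr_ge0.
rewrite (ger0_norm t0) (ger0_norm s0).
have [->|tn0] := eqVneq t 0; first by rewrite mul0r add0r subr0 mul1r.
have tp : 0 < t by rewrite lt0r tn0.
have -> : e = t * e + (1 - t) * e by rewrite -mulrDl addrC subrK mul1r.
by apply: ltr_leD; [rewrite ltr_pM2l|apply: ler_wpM2l => //; exact: ltW].
Qed.

(** The separating direction is z minus the point c of A nearest to z: were some
    y in A to form an acute angle with it at c, moving from c towards y would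
    bring the point closer to z. *)
Lemma strict_separation A z : closed A -> convex_set A -> A !=set0 -> ~ A z ->
  exists2 d, d != 0 & forall y, A y -> dot d y + dot d d <= dot d z.
Proof.
move=> clA /convex_setP cA [y0 Ay0] Az.
pose f y := dot (y - z) (y - z).
have cf : continuous f.
  move=> y; apply: (@cvg_dot _ _ _ (nbhs y));
    by apply: (@cvgB _ _ _ (nbhs y) _ id (cst z)); [exact: cvg_id|exact: cvg_cst].
(* Only the points at least as close as y0 matter, and they form a compact set. *)
pose B := A `&` [set y | f y <= f y0].
have B0 : B !=set0 by exists y0; split=> /=.
have cB : compact B.
  apply: bounded_closed_compact.
    exists (Num.sqrt (f y0) + `|z|); split=> [|M ltM y [_ /= fy]].
      by rewrite num_real.
    apply: le_trans (ltW ltM); rewrite -[y](subrK z).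
    apply: le_trans (ler_normD _ _) _; rewrite lerD2r.
    rewrite -(@ler_sqr R) ?nnegrE ?sqrtr_ge0// sqr_sqrtr; last exact: dot_ge0.
    exact: le_trans (sqr_norm_le_dot _) fy.
  apply: closedI => //; apply: (@preimage_closed _ _ f [set t | t <= f y0]).
    by move=> y _; exact: cf.
  exact: closed_le.
have [c cB' cmin] : exists2 c, c \in B & forall y, y \in B -> f c <= f y.
  by apply: EVT_min_rV => // ; apply: continuous_subspaceT.
move: cB'; rewrite inE => -[Ac /= fc].
have {}cmin y : A y -> f c <= f y.
  move=> Ay; have [fy|/ltW fy] := leP (f y) (f y0).
    by apply: cmin; rewrite inE.
  exact: le_trans fc fy.
have zc : z - c != 0.
  by rewrite subr_eq0; apply/eqP => zc; apply: Az; rewrite zc.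
exists (z - c) => // y Ay.
suff : dot (z - c) (y - c) <= 0.
  rewrite !(dotBl, dotBr) (dotC z c); lra.
rewrite leNgt; apply/negP => P0.
set P := dot (z - c) (y - c) in P0.
set Q := dot (y - c) (y - c).
have Q0 : 0 <= Q := dot_ge0 _.
(* Any t in ]0, 1] below 2P/Q makes c + t(y - c) closer to z; this choice also
   makes sense when Q = 0. *)
pose t := P / (P + Q).
have PQ : 0 < P + Q by rewrite ltr_wpDr.
have t0 : 0 < t by rewrite divr_gt0.
have t1 : t <= 1 by rewrite ler_pdivrMr// mul1r lerDl.
have := cmin _ (cA _ _ _ Ay Ac (ltW t0) t1).
have -> : f (t *: y + (1 - t) *: c) = f c - 2 * t * P + t ^+ 2 * Q.
  rewrite /f.
  have -> : t *: y + (1 - t) *: c - z = (c - z) + t *: (y - c).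
    by apply/rowP => i; rewrite !mxE; ring.
  rewrite dot_sqrD -/Q.
  have -> : dot (c - z) (y - c) = - P by rewrite -dotNl opprB.
  ring.
have : t * Q < P * 1.
  rewrite /t mulrAC -mulrA ltr_pM2l// ltr_pdivrMr// mul1r; lra.
rewrite mulr1 => tQ; rewrite -subr_ge0.
have -> : f c - 2 * t * P + t ^+ 2 * Q - f c = t * (t * Q - 2 * P) by ring.
by rewrite pmulr_rge0//; lra.
Qed.

(** If a + b is close to z with a in A and b in B, then b is close to z - a; a
    cluster point of such a's in the compact set A gives the decomposition. *)
Lemma closed_mink_add A B : compact A -> closed B -> closed (mink_add A B).
Proof.
move=> cA clB z clz.
pose G e := [set a | A a /\ exists2 b, B b & `|z - (a + b)| < e].
have G0 e : 0 < e -> G e !=set0.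
  move=> e0; have [_ [a Aa [b Bb <-]] zab] := (closureP _ _).1 clz e e0.
  by exists a; split=> //; exists b.
pose F : set_system 'rV[R]_n := [set V | exists2 e, 0 < e & G e `<=` V].
have FF : ProperFilter F.
  split.
    by move=> [e e0 Ge]; have [a /Ge] := G0 e e0.
  split=> [|V W [e e0 Ve] [e' e'0 We']|V W VW [e e0 Ve]].
  - by exists 1.
  - exists (Num.min e e'); first by rewrite lt_min e0.
    move=> a [Aa [b Bb]]; rewrite lt_min => /andP[abe abe'].
    by split; [apply: Ve|apply: We']; split=> //; exists b.
  - by exists e => // a /Ve /VW.
have FA : F A by exists 1 => // a [].
have [a [Aa clF]] := cA F FF FA.
exists a => //; exists (z - a); last by rewrite addrC subrK.
apply: clB; apply/closureP => e e0.
have e20 : 0 < e / 2 by rewrite divr_gt0.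
have FG : F (G (e / 2)) by exists (e / 2).
have [a' [[Aa' [b Bb zb]]]] := clF _ _ FG (nbhsx_ballx a _ e20).
rewrite -ball_normE /= => aa'; exists b => //.
have -> : z - a - b = (z - (a' + b)) - (a - a').
  by apply/rowP => i; rewrite !mxE; ring.
by apply: le_lt_trans (ler_normB _ _) _; rewrite [e]splitr ltrD.
Qed.

End convexity.

(** * One-sided directional derivatives of convex functions *)

Section directional_derivative.
Context {R : realType} {n : nat}.
Implicit Types (U : set 'rV[R]_n) (h P : 'rV[R]_n -> R) (x d e s w : 'rV[R]_n).

Definition diff_quot h x d (t : R) : R := t^-1 * (h (x + t *: d) - h x).

Lemma open_near_right U x d : open U -> U x ->
  \forall t \near 0^'+, U (x + t *: d).
Proof.
move=> oU Ux; have cvgx : x + t *: d @[t --> (0 : R)^'+] --> x.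
  have c0 : t *: d @[t --> (0 : R)^'+] --> (0 : R) *: d.
    by apply: cvgZr_tmp; apply: cvg_at_right_filter.
  have : x + t *: d @[t --> (0 : R)^'+] --> x + 0 *: d.
    by apply: cvgD c0; exact: cvg_cst.
  by rewrite scale0r addr0.
by apply: cvgx; exact: open_nbhs_nbhs.
Qed.

(** Convexity makes the difference quotient nondecreasing in the step, so its
    limit at 0 is its infimum. *)
Lemma diff_quot_mono U h x d (s t : R) : convex_function U h -> U x ->
  0 < s -> s <= t -> U (x + t *: d) -> diff_quot h x d s <= diff_quot h x d t.
Proof.
move=> /convex_functionP ch Ux s0 st Ut.
have t0 : 0 < t by exact: lt_le_trans st.
rewrite /diff_quot ler_pdivrMl// mulrA -[s / t]/(s * t^-1).
have st1 : s / t <= 1 by rewrite ler_pdivrMr// mul1r.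
have := ch _ _ _ Ut Ux (ltW (divr_gt0 s0 t0)) st1.
have -> : (s / t) *: (x + t *: d) + (1 - s / t) *: x = x + s *: d.
  by apply/rowP => i; rewrite !mxE; field; rewrite gt_eqF.
by move=> H; rewrite mulrBr lerBlDr (le_trans H)//; lra.
Qed.

(** Bounds the quotients along d below by a backward quotient, so their infimum
    is finite at an interior point. *)
Lemma diff_quot_lower U h x d (r t : R) : convex_function U h ->
  0 < r -> 0 < t -> U (x - r *: d) -> U (x + t *: d) ->
  - diff_quot h x (- d) r <= diff_quot h x d t.
Proof.
move=> /convex_functionP ch r0 t0 Ur Ut.
have rt : 0 < r + t by rewrite addr_gt0.
have := ch _ _ (r / (r + t)) Ut Ur (ltW (divr_gt0 r0 rt)).
have -> : (r / (r + t)) *: (x + t *: d) + (1 - r / (r + t)) *: (x - r *: d) = x.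
  by apply/rowP => i; rewrite !mxE; field; rewrite gt_eqF.
rewrite ler_pdivrMr// mul1r lerDl (ltW t0) => /(_ isT) H.
rewrite /diff_quot scalerN -subr_ge0 opprK.
have -> : t^-1 * (h (x + t *: d) - h x) + r^-1 * (h (x - r *: d) - h x) =
    (r + t) / (r * t) *
    (r / (r + t) * h (x + t *: d) + (1 - r / (r + t)) * h (x - r *: d) - h x).
  by field; rewrite !gt_eqF.
by rewrite mulr_ge0 ?subr_ge0// divr_ge0 ?mulr_ge0// ltW.
Qed.

Section convex_fun.
Variables (U : set 'rV[R]_n) (h : 'rV[R]_n -> R) (x : 'rV[R]_n).
Hypotheses (oU : open U) (ch : convex_function U h) (Ux : U x).

Let right_radius d :
  exists2 r : R, 0 < r & forall t, 0 < t -> t < r -> U (x + t *: d).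
Proof.
have [r /= r0 Ur] := open_near_right d oU Ux.
exists r => // t t0 tr; apply: Ur => //=.
by rewrite sub0r normrN gtr0_norm.
Qed.

Lemma dir_deriv_cvg d :
  diff_quot h x d t @[t --> 0^'+] --> dir_deriv h x d.
Proof.
have [r r0 Ur] := right_radius d; have [r' r'0 Ur'] := right_radius (- d).
have r'2 : 0 < r' / 2 by rewrite divr_gt0.
suff : cvg (diff_quot h x d t @[t --> 0^'+]) by [].
apply/cvg_ex; eexists; apply: (@nondecreasing_at_right_cvgr _ _ _ (BLeft r)).
- by rewrite bnd_simp.
- move=> s t; rewrite !in_itv/= => /andP[s0 _] /andP[t0 tr] st.
  by apply: diff_quot_mono ch Ux _ _ _ => //; exact: Ur.
- exists (- diff_quot h x (- d) (r' / 2)) => _ [t /= + <-].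
  rewrite in_itv/= => /andP[t0 tr]; apply: diff_quot_lower ch _ _ _ _ => //.
    rewrite -scalerN; apply: Ur' => //; lra.
  exact: Ur.
Qed.

Lemma dir_deriv_le d (t : R) :
  0 < t -> U (x + t *: d) -> dir_deriv h x d <= diff_quot h x d t.
Proof.
move=> t0 Ut; rewrite /dir_deriv; apply: limr_le.
  by apply/cvg_ex; eexists; exact: dir_deriv_cvg.
near=> s; apply: diff_quot_mono ch Ux _ _ Ut => //.
by near: s; exact: nbhs_right_le.
Unshelve. all: by end_near. Qed.

Lemma dir_deriv_near d (eta : R) : 0 < eta ->
  \forall t \near 0^'+, h (x + t *: d) <= h x + t * (dir_deriv h x d + eta).
Proof.
move=> eta0; near=> t.
have t0 : 0 < t by [].
rewrite -lerBlDl -ler_pdivrMl//; apply: ltW.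
near: t; apply: cvgr_lt; first exact: dir_deriv_cvg.
by rewrite ltrDl.
Unshelve. all: by end_near. Qed.

Lemma dir_deriv_ge d (c : R) :
  (\forall t \near 0^'+, c <= diff_quot h x d t) -> c <= dir_deriv h x d.
Proof.
by rewrite /dir_deriv; apply: limr_ge; apply/cvg_ex; eexists; exact: dir_deriv_cvg.
Qed.

End convex_fun.
End directional_derivative.

(** * Supporting a sublinear function by a linear one *)

Section sublinear.
Context {R : realType} {n : nat}.
Implicit Types (P Q : 'rV[R]_n -> R) (d e s w : 'rV[R]_n).

Definition sublinear P :=
  (forall v w, P (v + w) <= P v + P w) /\
  (forall (t : R) w, 0 <= t -> P (t *: w) = t * P w).

(** Subadditivity comes from the midpoint inequality
    x + t(v + w) = ((x + 2tv) + (x + 2tw)) / 2. *)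
Lemma dir_deriv_sublinear (U : set 'rV[R]_n) h x :
  open U -> convex_function U h -> U x -> sublinear (dir_deriv h x).
Proof.
move=> oU ch Ux.
have homog_le (c : R) w : 0 < c ->
    dir_deriv h x (c *: w) <= c * dir_deriv h x w.
  move=> c0; rewrite -ler_pdivrMl//.
  apply: (dir_deriv_ge oU ch Ux).
  have cU := open_near_right w oU Ux.
  have cUc := open_near_right (c *: w) oU Ux.
  have [r /= r0 Ur] := cUc.
  near=> t.
  have t0 : 0 < t by [].
  have tc0 : 0 < t / c by rewrite divr_gt0.
  have tc : (t / c) *: (c *: w) = t *: w.
    by rewrite scalerA divfK// gt_eqF.
  rewrite ler_pdivrMl//.
  have <- : diff_quot h x (c *: w) (t / c) = c * diff_quot h x w t.
    by rewrite /diff_quot tc invf_div mulrA.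
  by apply: (dir_deriv_le oU ch Ux) => //; rewrite tc; near: t.
have homog (c : R) w : 0 < c -> dir_deriv h x (c *: w) = c * dir_deriv h x w.
  move=> c0; apply/eqP; rewrite eq_le homog_le//=.
  have ci0 : 0 < c^-1 by rewrite invr_gt0.
  have := homog_le _ (c *: w) ci0.
  by rewrite scalerA mulVf ?gt_eqF// scale1r ler_pdivlMl.
split=> [v w|t w]; last first.
  rewrite le_eqVlt => /predU1P[<-|]; last exact: homog.
  rewrite scale0r mul0r; have := homog 2 0 (ltr0n _ 2); rewrite scaler0; lra.
apply/ler_addgt0Pr => eta eta0.
have e2 : 0 < eta / 2 by rewrite divr_gt0.
have vw : v + w = (1 / 2 : R) *: (2 *: v + 2 *: w).
  by rewrite -scalerDr scalerA mul1r mulVf// scale1r.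
have oUv := open_near_right (2 *: v) oU Ux.
have oUw := open_near_right (2 *: w) oU Ux.
have oUvw := open_near_right (v + w) oU Ux.
have Dv := dir_deriv_near oU ch Ux (2 *: v) eta0.
have Dw := dir_deriv_near oU ch Ux (2 *: w) eta0.
near (0 : R)^'+ => t.
have t0 : 0 < t by [].
have Uv : U (x + t *: (2 *: v)) by near: t.
have Uw : U (x + t *: (2 *: w)) by near: t.
have Uvw : U (x + t *: (v + w)) by near: t.
have hDv : h (x + t *: (2 *: v)) <= h x + t * (dir_deriv h x (2 *: v) + eta).
  by near: t.
have hDw : h (x + t *: (2 *: w)) <= h x + t * (dir_deriv h x (2 *: w) + eta).
  by near: t.
apply: le_trans (dir_deriv_le oU ch Ux t0 Uvw) _.
rewrite /diff_quot ler_pdivrMl// lerBlDl.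
have h0 : 0 <= 1 / 2 :> R by lra.
have h1 : 1 / 2 <= 1 :> R by lra.
have := convex_functionP ch Uv Uw h0 h1.
have -> : (1 / 2 : R) *: (x + t *: (2 *: v)) + (1 - 1 / 2) *: (x + t *: (2 *: w))
     = x + t *: (v + w).
  by apply/rowP => i; rewrite !mxE; field.
move=> /le_trans; apply.
rewrite !homog// in hDv hDw.
have -> : h x + t * (dir_deriv h x v + dir_deriv h x w + eta) =
  1 / 2 * (h x + t * (2 * dir_deriv h x v + eta)) +
  (1 - 1 / 2) * (h x + t * (2 * dir_deriv h x w + eta)) by field.
by apply: lerD; apply: ler_wpM2l => //; lra.
Unshelve. all: by end_near. Qed.

Lemma sublinear_convex P : sublinear P -> convex_function setT P.
Proof.
move=> [PD PZ] t v w _ _.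
have := PD (t%:num *: v) ((1 - t%:num) *: w).
by rewrite !PZ// subr_ge0.
Qed.

Lemma sublinear_oppr P w : sublinear P -> - P (- w) <= P w.
Proof.
move=> [PD PZ]; have := PD w (- w); rewrite subrr.
have := PZ 0 0 (lexx _); rewrite scale0r mul0r => ->; lra.
Qed.

(** Differentiating a sublinear P at e produces a smaller sublinear function
    that is linear on the line spanned by e and still equals P e at e.  This
    plays the part of the one-dimensional extension step of Hahn-Banach. *)
Lemma dir_deriv_sublinear_minorant P e : sublinear P ->
  [/\ sublinear (dir_deriv P e), forall w, dir_deriv P e w <= P w &
      dir_deriv P e (- e) <= - P e].
Proof.
move=> sP; have cP := sublinear_convex sP; have [PD PZ] := sP.
have oT : open [set: 'rV[R]_n] := openT.
split; first exact: (dir_deriv_sublinear oT cP).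
  move=> w; apply: le_trans (dir_deriv_le oT cP _ (ltr01) _) _ => //.
  by rewrite /diff_quot invr1 mul1r scale1r lerBlDl.
(* A step of length 1 / 2 towards - e stays on the ray of e, where P is linear. *)
have h0 : 0 < 1 / 2 :> R by lra.
apply: le_trans (dir_deriv_le oT cP _ h0 _) _ => //.
rewrite /diff_quot; have -> : e + (1 / 2) *: - e = (1 / 2) *: e.
  by apply/rowP => i; rewrite !mxE; field.
rewrite (PZ _ _ (ltW h0)).
have -> : (1 / 2 : R)^-1 * (1 / 2 * P e - P e) = - P e by field.
exact: lexx.
Qed.

(** Linearity along a line is inherited by every sublinear minorant, so the
    lines can be treated one after the other. *)
Lemma sublinear_linear_on P (l : seq 'rV[R]_n) : sublinear P ->
  exists Q, [/\ sublinear Q, forall w, Q w <= P w &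
                forall e, e \in l -> Q (- e) <= - Q e].
Proof.
elim: l P => [|e l IH] P sP; first by exists P.
have [sP1 P1P P1e] := dir_deriv_sublinear_minorant e sP.
have [Q [sQ QP1 Ql]] := IH _ sP1.
exists Q; split=> // [w|e']; first exact: le_trans (QP1 w) (P1P w).
rewrite inE => /predU1P[->|]; last exact: Ql.
have := QP1 (- e); have := QP1 e; have := P1P e; lra.
Qed.

(** Linearize P first along d, which fixes the value at d, and then along the
    coordinate axes, which leaves a linear function. *)
Lemma sublinear_support P d : sublinear P ->
  exists2 s, (forall w, dot s w <= P w) & dot s d = P d.
Proof.
move=> sP; have [sP1 P1P P1d] := dir_deriv_sublinear_minorant d sP.
have [Q [sQ QP1 Qe]] :=
  sublinear_linear_on [seq delta_mx 0 i | i : 'I_n] sP1.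
have [QD QZ] := sQ.
have Qo : forall i, Q (- delta_mx 0 i) = - Q (delta_mx 0 i).
  move=> i; apply/eqP; rewrite eq_le Qe/=; last by rewrite map_f ?mem_enum.
  by have := sublinear_oppr (delta_mx 0 i) sQ; lra.
have QZe : forall (c : R) (i : 'I_n), Q (c *: delta_mx 0 i) = c * Q (delta_mx 0 i).
  move=> c k; have [c0|c0] := leP 0 c; first exact: QZ.
  by rewrite -[in LHS](opprK c) scaleNr -scalerN QZ ?oppr_ge0 1?ltW// Qo mulrNN.
pose s : 'rV[R]_n := \row_i Q (delta_mx 0 i).
have Qs w : Q w <= dot s w.
  rewrite {1}(row_sum_coord w) /dot.
  apply: (big_ind2 (fun v a => Q v <= a)) => [|v a v2 a2 va va2|j _].
  - by have := QZ 0 0 (lexx _); rewrite scale0r mul0r => ->.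
  - by apply: le_trans (QD _ _) _; exact: lerD.
  - by rewrite QZe mxE mulrC.
have sQ' w : dot s w <= Q w.
  have := Qs (- w); rewrite dotNr; have := sublinear_oppr w sQ; lra.
exists s => [w|]; first exact: le_trans (sQ' w) (le_trans (QP1 w) (P1P w)).
apply/eqP; rewrite eq_le; apply/andP; split.
  exact: le_trans (sQ' d) (le_trans (QP1 d) (P1P d)).
by have := le_trans (sQ' (- d)) (QP1 _); rewrite dotNr; lra.
Qed.

End sublinear.

(** * Subdifferentials of convex functions *)

Section subdifferential.
Context {R : realType} {n : nat}.
Variables (U : set 'rV[R]_n) (h : 'rV[R]_n -> R) (x : 'rV[R]_n).
Hypotheses (oU : open U) (ch : convex_function U h) (Ux : U x).
Implicit Types (d e s w : 'rV[R]_n).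

Lemma subdiffP s : subdiff U h x s <-> forall d, dot s d <= dir_deriv h x d.
Proof.
split=> [sh d|sD y Uy]; last first.
  have := sD (y - x); have xy : x + (1 : R) *: (y - x) = y.
    by rewrite scale1r addrC subrK.
  have := dir_deriv_le oU ch Ux (d := y - x) (@ltr01 R).
  by rewrite /diff_quot xy invr1 mul1r => /(_ Uy); lra.
apply: (dir_deriv_ge oU ch Ux).
have cU := open_near_right d oU Ux.
near=> t.
have t0 : 0 < t by [].
rewrite /diff_quot ler_pdivlMl// lerBrDl -dotZr.
have -> : t *: d = (x + t *: d) - x by rewrite addrAC subrr add0r.
by rewrite addrCA subrr addr0; apply: sh; near: t.
Unshelve. all: by end_near. Qed.

(** The max formula: h'(x; d) is the maximum of s.d over the subdifferential,
    the other inequality being [subdiffP]. *)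
Lemma subdiff_dir_deriv d :
  exists2 s, subdiff U h x s & dot s d = dir_deriv h x d.
Proof.
have [s sD sd] := sublinear_support d (dir_deriv_sublinear oU ch Ux).
by exists s => //; apply/subdiffP.
Qed.

Lemma subdiff_nonempty : subdiff U h x !=set0.
Proof. by have [s] := subdiff_dir_deriv 0; exists s. Qed.

Lemma subdiff_convex : convex_set (subdiff U h x).
Proof.
apply/convex_setP => s s' t sh s'h t0 t1 y Uy.
have t1' : 0 <= 1 - t by rewrite subr_ge0.
rewrite dotDl !dotZl.
have := ler_wpM2l t0 (sh y Uy); have := ler_wpM2l t1' (s'h y Uy); lra.
Qed.

Lemma subdiff_compact : compact (subdiff U h x).
Proof.
apply: bounded_closed_compact; last first.
  have -> : subdiff U h x = \bigcap_d [set s | dot d s <= dir_deriv h x d].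
    apply/seteqP; split=> s.
      by move=> /subdiffP sD d _ /=; rewrite dotC.
    by move=> sD; apply/subdiffP => d; rewrite dotC; exact: sD.
  by apply: closed_bigI => d _; exact: closed_halfspace.
pose D i : R := `|dir_deriv h x (delta_mx 0 i)|
              + `|dir_deriv h x (- delta_mx 0 i)|.
have D0 i : 0 <= D i by rewrite addr_ge0.
exists (\sum_i D i); split=> [|M ltM s /subdiffP sD].
  by rewrite num_real.
apply: le_trans (ltW ltM); apply: norm_le_coord => [|i].
  by apply: sumr_ge0 => i _.
apply: (@le_trans _ _ (D i)); last first.
  by rewrite (bigD1 i)//= lerDl; apply: sumr_ge0.
have := sD (delta_mx 0 i); have := sD (- delta_mx 0 i).
rewrite dotNr dot_delta /D ler_norml.
have := ler_norm (dir_deriv h x (delta_mx 0 i)).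
have := ler_norm (dir_deriv h x (- delta_mx 0 i)).
have := normr_ge0 (dir_deriv h x (delta_mx 0 i)).
have := normr_ge0 (dir_deriv h x (- delta_mx 0 i)).
by move=> *; apply/andP; split; lra.
Qed.

Hypothesis cU : convex_set U.

Let near_radius d (eta : R) : 0 < eta -> exists2 r : R, 0 < r &
  forall t, 0 < t -> t < r -> U (x + t *: d) /\
    h (x + t *: d) <= h x + t * (dir_deriv h x d + eta).
Proof.
move=> eta0; have Ud := open_near_right d oU Ux.
have Dd := dir_deriv_near oU ch Ux d eta0.
have [r /= r0 rP] := filterI Ud Dd.
exists r => // t t0 tr; apply: rP => //=.
by rewrite sub0r normrN gtr0_norm.
Qed.

Let segment_bound d e : exists K, exists2 r : R, 0 < r &
  forall t a, 0 < t -> t < r -> `|a| <= 1 ->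
    U (x + t *: (d + a *: e)) /\ h (x + t *: (d + a *: e)) <= h x + t * K.
Proof.
have [r1 r10 P1] := near_radius (d + e) (@ltr01 R).
have [r2 r20 P2] := near_radius (d - e) (@ltr01 R).
pose K1 := dir_deriv h x (d + e) + 1.
pose K2 := dir_deriv h x (d - e) + 1.
exists (Num.max K1 K2), (Num.min r1 r2); first by rewrite lt_min r10.
move=> t a t0; rewrite lt_min ler_norml => /andP[tr1 tr2] /andP[a1 a2].
have [U1 h1] := P1 t t0 tr1; have [U2 h2] := P2 t t0 tr2.
have th0 : 0 <= (1 + a) / 2 by lra.
have th1 : (1 + a) / 2 <= 1 by lra.
have th1' : 0 <= 1 - (1 + a) / 2 by lra.
have -> : x + t *: (d + a *: e) = ((1 + a) / 2) *: (x + t *: (d + e)) +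
    (1 - (1 + a) / 2) *: (x + t *: (d - e)).
  by apply/rowP => i; rewrite !mxE; field.
split; first by apply: (convex_setP U).1.
apply: le_trans (convex_functionP ch U1 U2 th0 th1) _.
have {}h1 : h (x + t *: (d + e)) <= h x + t * Num.max K1 K2.
  by apply: le_trans h1 _; rewrite lerD2l ler_pM2l// le_max lexx.
have {}h2 : h (x + t *: (d - e)) <= h x + t * Num.max K1 K2.
  by apply: le_trans h2 _; rewrite lerD2l ler_pM2l// le_max lexx orbT.
have := ler_wpM2l th0 h1; have := ler_wpM2l th1' h2; lra.
Qed.

(** The estimate along d persists for directions near d.  Coordinates are
    perturbed one at a time: a perturbation by c e is written as the average,
    with a small weight la on d + (c / la) e and weight 1 - la on the directions
    already treated.  The value at the former is only known to be bounded
    ([segment_bound]), but its weight makes its contribution negligible. *)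
Lemma dir_deriv_locally_uniform d (eta : R) : 0 < eta ->
  exists2 r : R, 0 < r & forall t w, 0 < t -> t < r -> `|w - d| <= r ->
    U (x + t *: w) /\ h (x + t *: w) <= h x + t * (dir_deriv h x d + eta).
Proof.
pose S (c : 'I_n -> R) l : 'rV[R]_n := \sum_(i <- l) c i *: delta_mx 0 i.
suff H l : forall eta, 0 < eta ->
    exists2 r : R, 0 < r & forall t c, 0 < t -> t < r ->
      (forall i, `|c i| <= r) ->
      U (x + t *: (d + S c l)) /\
      h (x + t *: (d + S c l)) <= h x + t * (dir_deriv h x d + eta).
  move=> eta0; have [r r0 rP] := H (index_enum 'I_n) eta eta0.
  exists r => // t w t0 tr wd.
  have -> : w = d + S (fun i => (w - d) 0 i) (index_enum 'I_n).
    by rewrite /S -row_sum_coord addrC subrK.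
  by apply: rP => // i; apply: le_trans wd; exact: coord_le_norm.
elim: l => [|j l IH] {}eta eta0.
  have [r r0 rP] := near_radius d eta0.
  by exists r => // t c t0 tr _; rewrite /S big_nil addr0; exact: rP.
have e20 : 0 < eta / 2 by rewrite divr_gt0.
have [r2 r20 P2] := IH _ e20.
have [K [r1 r10 P1]] := segment_bound d (delta_mx 0 j).
set D := dir_deriv h x d in P2 *.
pose B := `|K - D - eta / 2| + 1.
have B0 : 0 < B by rewrite ltr_wpDl.
(* Small enough for the excess K - D over the expected slope D to cost at most
   eta / 2, and at most 1/2 so that dividing by 1 - la at most doubles. *)
pose la := Num.min (1 / 2) (eta / 2 / B).
have la0 : 0 < la by rewrite lt_min; apply/andP; split; [lra|rewrite divr_gt0].
have la2 : la <= 1 / 2 by rewrite ge_min lexx.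
have laB : la * (K - D - eta / 2) <= eta / 2.
  apply: (@le_trans _ _ (la * B)).
    by rewrite ler_pM2l// /B; have := ler_norm (K - D - eta / 2); lra.
  by rewrite -ler_pdivlMr// ge_min lexx orbT.
exists (Num.min r1 (Num.min (r2 / 2) la)).
  by rewrite lt_min r10/= lt_min la0 andbT divr_gt0.
move=> t c t0; rewrite lt_min => /andP[tr1]; rewrite lt_min => /andP[tr2 tla] cr.
have la1 : 0 < 1 - la by lra.
have cj : `|c j / la| <= 1.
  rewrite normrM normfV (gtr0_norm la0) ler_pdivrMr// mul1r.
  by apply: le_trans (cr j) _; rewrite ge_min ge_min lexx ?orbT.
have ci i : `|c i / (1 - la)| <= r2.
  rewrite normrM normfV (gtr0_norm la1) ler_pdivrMr//.
  apply: (@le_trans _ _ (r2 / 2)).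
    by apply: le_trans (cr i) _; rewrite ge_min ge_min lexx ?orbT.
  by rewrite ler_pM2l//; lra.
have tr2' : t < r2 by lra.
have [U2 h2] := P2 t (fun i => c i / (1 - la)) t0 tr2' ci.
have [U1 h1] := P1 t (c j / la) t0 tr1 cj.
have -> : x + t *: (d + S c (j :: l)) =
    la *: (x + t *: (d + (c j / la) *: delta_mx 0 j)) +
    (1 - la) *: (x + t *: (d + S (fun i => c i / (1 - la)) l)).
  have Sl : S c l = (1 - la) *: S (fun i => c i / (1 - la)) l.
    rewrite /S scaler_sumr; apply: eq_bigr => i _.
    by rewrite scalerA mulrC divfK// gt_eqF.
  rewrite {1}/S big_cons -/(S c l) Sl; set s := S _ _.
  by apply/rowP => i; rewrite !mxE; field; rewrite gt_eqF.
have la1' : la <= 1 by lra.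
split; first by apply: (convex_setP U).1 => //; exact: ltW.
apply: le_trans (convex_functionP ch U1 U2 (ltW la0) la1') _.
apply: (@le_trans _ _ (la * (h x + t * K) +
                       (1 - la) * (h x + t * (D + eta / 2)))).
  by apply: lerD; rewrite ler_pM2l.
have := ler_wpM2l (ltW t0) laB; lra.
Qed.

End subdifferential.

(** * Uniform upper first-order estimates *)

Section upper_slope.
Context {R : realType} {n : nat}.
Implicit Types (h v : 'rV[R]_n -> R) (x d e s w : 'rV[R]_n).

(** A number c at least as large as the upper Hadamard derivative of h at x along
    d: the direction w may vary together with the step.  Only upper bounds are
    asked for, so that concave terms can be bounded through a subgradient. *)
Definition upper_slope h x d (c : R) := forall eta, 0 < eta ->
  exists2 r : R, 0 < r & forall t w, 0 < t -> t < r -> `|w - d| <= r ->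
    h (x + t *: w) <= h x + t * (c + eta).

Lemma upper_slopeD h v x d a b : upper_slope h x d a -> upper_slope v x d b ->
  upper_slope (h \+ v) x d (a + b).
Proof.
move=> ha vb eta eta0; have e20 : 0 < eta / 2 by rewrite divr_gt0.
have [r r0 hr] := ha _ e20; have [r' r'0 vr] := vb _ e20.
exists (Num.min r r') => [|t w t0]; first by rewrite lt_min r0.
rewrite lt_min le_min => /andP[tr tr'] /andP[wr wr'] /=.
by have := hr t w t0 tr wr; have := vr t w t0 tr' wr'; lra.
Qed.

Lemma gradientE h x d : differentiable h x -> 'd h x d = dot (gradient h x) d.
Proof.
move=> dh; rewrite {1}(row_sum_coord d) linear_sum; apply: eq_bigr => i _.
by rewrite linearZ/= mxE deriveE// mulrC.
Qed.

(** The two-sided derivative and the one-sided one agree once the former exists. *)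
Lemma dir_deriv_differentiable h x d : differentiable h x ->
  dir_deriv h x d = dot (gradient h x) d.
Proof.
move=> dh; rewrite -gradientE// -deriveE// /dir_deriv /derive.
rewrite cvg_at_rightE; last by have /= := @diff_derivable _ _ _ _ _ d dh.
apply: (congr1 (fun F : R -> R => lim (F t @[t --> 0^'+]))).
by apply/funext => t /=; rewrite (addrC x).
Qed.

Lemma dot_norm_bound s w : `|dot s w| <= (\sum_i `|s 0 i|) * `|w|.
Proof.
rewrite mulr_suml; apply: le_trans (ler_norm_sum _ _ _) _.
by apply: ler_sum => i _; rewrite normrM ler_wpM2l// coord_le_norm.
Qed.

Lemma dot_near s d (eta : R) : 0 < eta ->
  exists2 r : R, 0 < r & forall w, `|w - d| <= r -> `|dot s (w - d)| <= eta.
Proof.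
move=> eta0; set B := \sum_i `|s 0 i|.
have B0 : 0 <= B by apply: sumr_ge0.
have B1 : 0 < B + 1 by rewrite ltr_wpDl.
exists (eta / (B + 1)) => [|w wd]; first by rewrite divr_gt0.
apply: le_trans (dot_norm_bound _ _) _; rewrite -/B.
apply: le_trans (ler_wpM2l B0 wd) _.
by rewrite mulrCA ler_piMr ?(ltW eta0)// ler_pdivrMr// mul1r lerDl.
Qed.

Lemma upper_slope_differentiable h x d : differentiable h x ->
  upper_slope h x d (dot (gradient h x) d).
Proof.
move=> dh eta eta0; have e20 : 0 < eta / 2 by rewrite divr_gt0.
have [r1 r10 P1] := dot_near (gradient h x) d e20.
(* B bounds all directions at distance at most 1 from d, hence the second radius. *)
pose B := `|d| + 1.
have B0 : 0 < B by rewrite ltr_wpDl.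
have [_ /eqaddoP/(_ (eta / 2 / B))] := (diff_locallyP x h).1 dh.
rewrite divr_gt0// => /(_ isT)/nbhs_ballP[r2 /= r20 P2].
exists (Num.min r1 (Num.min 1 (r2 / B))) => [|t w t0].
  by rewrite lt_min r10 lt_min ltr01 divr_gt0.
rewrite lt_min => /andP[_]; rewrite lt_min => /andP[_ tr2].
rewrite le_min => /andP[wr1]; rewrite le_min => /andP[wr _].
have wB : `|w| <= B.
  by rewrite -[w](subrK d) /B [leRHS]addrC (le_trans (ler_normD _ _))// lerD2r.
have twB : `|t *: w| <= t * B by rewrite normrZ gtr0_norm// ler_pM2l.
have : ball 0 r2 (t *: w).
  rewrite -ball_normE /= sub0r normrN (le_lt_trans twB)//.
  by rewrite -ltr_pdivlMr.
move=> /P2; rewrite /= !fctE /= gradientE// dotZr.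
have := P1 w wr1; rewrite dotBr ler_norml => /andP[_ dw].
have -> : t *: w + x = x + t *: w by rewrite addrC.
rewrite ler_norml => /andP[_ H].
have : eta / 2 / B * `|t *: w| <= t * (eta / 2).
  apply: le_trans (ler_wpM2l _ twB) _; first by rewrite !divr_ge0 ?ltW.
  by rewrite mulrCA divfK ?gt_eqF.
have := ler_wpM2l (ltW t0) dw; lra.
Qed.

Section convex_fun.
Variables (U : set 'rV[R]_n) (h : 'rV[R]_n -> R) (x : 'rV[R]_n).
Hypotheses (oU : open U) (cU : convex_set U) (ch : convex_function U h).
Hypothesis (Ux : U x).

Lemma upper_slope_convex d : upper_slope h x d (dir_deriv h x d).
Proof.
move=> eta eta0.
have [r r0 rP] := dir_deriv_locally_uniform oU ch Ux cU d eta0.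
by exists r => // t w t0 tr wd; have [] := rP t w t0 tr wd.
Qed.

Lemma upper_slope_concave s d : subdiff U h x s ->
  upper_slope (\- h) x d (- dot s d).
Proof.
move=> sh eta eta0.
have [r r0 rP] := dir_deriv_locally_uniform oU ch Ux cU d eta0.
have [r1 r10 P1] := dot_near s d eta0.
exists (Num.min r r1) => [|t w t0]; first by rewrite lt_min r0.
rewrite lt_min le_min => /andP[tr _] /andP[wr wr1] /=.
have [Uw _] := rP t w t0 tr wr.
have := sh _ Uw; rewrite addrAC subrr add0r dotZr.
have := P1 w wr1; rewrite dotBr ler_norml => /andP[dw _].
have := ler_wpM2l (ltW t0) dw; lra.
Qed.

End convex_fun.

Lemma upper_slope_seq h x d c (y : nat -> 'rV[R]_n) (t : nat -> R) :
  upper_slope h x d c -> (forall k, 0 < t k) ->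
  t k @[k --> \oo] --> 0 -> (t k)^-1 *: (y k - x) @[k --> \oo] --> d ->
  forall eta, 0 < eta ->
    \forall k \near \oo, h (y k) <= h x + t k * (c + eta).
Proof.
move=> hc t0 tcvg wcvg eta eta0; have [r r0 rP] := hc eta eta0.
near=> k.
have -> : y k = x + t k *: ((t k)^-1 *: (y k - x)).
  by rewrite scalerA divff ?gt_eqF// scale1r addrC subrK.
apply: rP => //.
  by near: k; apply: cvgr_lt; [exact: tcvg|].
by near: k; apply: cvgr_distC_le; [exact: wcvg|].
Unshelve. all: by end_near. Qed.

End upper_slope.

(** * Convex cones, tangent cones and Minkowski sums *)

Section cones.
Context {R : realType} {n : nat}.
Implicit Types (A B K X : set 'rV[R]_n) (x d s w : 'rV[R]_n).

Definition convex_cone K :=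
  (forall v w, K v -> K w -> K (v + w)) /\
  (forall (t : R) w, 0 <= t -> K w -> K (t *: w)).

Lemma convex_cone_convex K : convex_cone K -> convex_set K.
Proof.
move=> [KD KZ]; apply/convex_setP => v w t Kv Kw t0 t1.
by apply: KD; apply: KZ => //; rewrite subr_ge0.
Qed.

Lemma cone_convex_cone A : convex_set A -> convex_cone (cone A).
Proof.
move=> /convex_setP cA; split=> [_ _ [a /= a0 [v Av <-]] [b /= b0 [w Aw <-]]|].
  have [ab|ab] := eqVneq (a + b) 0.
    have [-> ->] : a = 0 /\ b = 0 by split; lra.
    by exists 0 => //=; exists v => //; rewrite !scale0r addr0.
  have ab0 : 0 < a + b by rewrite lt0r ab addr_ge0.
  exists (a + b); first exact: ltW.
  exists ((a / (a + b)) *: v + (1 - a / (a + b)) *: w).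
    by apply: cA; rewrite ?divr_ge0 ?ler_pdivrMr ?mul1r ?lerDl // ltW.
  by apply/rowP => i; rewrite !mxE; field.
move=> t _ t0 [a /= a0 [v Av <-]].
by exists (t * a); [exact: mulr_ge0|exists v; rewrite ?scalerA].
Qed.

Lemma normal_cone_convex_cone X x : convex_cone (normal_cone X x).
Proof.
split=> [v w Nv Nw y Xy|t w t0 Nw y Xy].
  by rewrite dotDl; have := Nv y Xy; have := Nw y Xy; lra.
by rewrite dotZl mulr_ge0_le0// Nw.
Qed.

Lemma mink_add_convex_cone A B :
  convex_cone A -> convex_cone B -> convex_cone (mink_add A B).
Proof.
move=> [AD AZ] [BD BZ]; split=> [_ _ [a Aa [b Bb <-]] [c Ac [e Be <-]]|].
  exists (a + c); first exact: AD.
  by exists (b + e); [exact: BD|rewrite addrACA].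
move=> t _ t0 [a Aa [b Bb <-]]; exists (t *: a); first exact: AZ.
by exists (t *: b); [exact: BZ|rewrite scalerDr].
Qed.

Lemma mink_add_convex A B :
  convex_set A -> convex_set B -> convex_set (mink_add A B).
Proof.
move=> /convex_setP cA /convex_setP cB; apply/convex_setP.
move=> _ _ t [a Aa [b Bb <-]] [c Ac [e Be <-]] t0 t1.
exists (t *: a + (1 - t) *: c); first exact: cA.
exists (t *: b + (1 - t) *: e); first exact: cB.
by rewrite !scalerDr addrACA.
Qed.

Lemma mink_subE A B : mink_sub A B = mink_add A (-%R @` B).
Proof.
apply/seteqP; split=> _ [a Aa [b Bb <-]].
  by exists a => //; exists (- b) => //; exists b.
by have [c Bc <-] := Bb; exists a => //; exists c.
Qed.

Lemma convex_set_opp A : convex_set A -> convex_set (-%R @` A).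
Proof.
move=> /convex_setP cA; apply/convex_setP => _ _ t [a Aa <-] [b Ab <-] t0 t1.
exists (t *: a + (1 - t) *: b); first exact: cA.
by rewrite opprD !scalerN.
Qed.

Lemma convex_set_set1 x : convex_set [set x].
Proof.
apply/convex_setP => _ _ t -> -> _ _ /=.
by rewrite -scalerDl addrC subrK scale1r.
Qed.

Lemma compact_opp A : compact A -> compact (-%R @` A).
Proof.
by move=> cA; apply: continuous_compact => //; apply: continuous_subspaceT => y;
  apply: opp_continuous.
Qed.

Lemma tangent_cone_polar X x d s :
  tangent_cone X x d -> normal_cone X x s -> dot s d <= 0.
Proof.
move=> [y [t [Xy t0 _ _ dcvg]]] Ns.
have scvg : dot s ((t k)^-1 *: (y k - x)) @[k --> \oo] --> dot s d.
  by apply: (cvg_dot (f := fun=> s)) dcvg; exact: cvg_cst.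
rewrite -(cvg_lim _ scvg)//; apply: limr_le; first by apply/cvg_ex; exists (dot s d).
apply: nearW => k; rewrite dotZr mulr_ge0_le0 ?invr_ge0 ?(ltW (t0 k))//.
exact: Ns (Xy k).
Qed.

(** Approximate d by feasible directions c k = a k (y k - x).  The step t k is
    chosen so that t k a k <= 1, which keeps x + t k c k on the segment from x to
    y k, and so that t k tends to 0 even if a k is unbounded. *)
Lemma closure_feasible_tangent_cone X x d : convex_set X -> X x ->
  closure (cone [set y - x | y in X]) d -> tangent_cone X x d.
Proof.
move=> /convex_setP cX Xx /closureP cld.
have kpos k : 0 < harmonic k :> R by rewrite invr_gt0.
have /choice[c cP] : forall k, exists c,
    cone [set y - x | y in X] c /\ `|d - c| < harmonic k.
  by move=> k; have [w Cw dw] := cld _ (kpos k); exists w.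
have /choice[a aP] : forall k, exists a : R,
    0 <= a /\ exists2 y, X y & c k = a *: (y - x).
  move=> k; have [[a a0 [_ [y Xy <-] <-]] _] := cP k.
  by exists a; split=> //; exists y.
have ccvg : c k @[k --> \oo] --> d.
  apply/cvgrPdist_lt => e e0; near=> k.
  apply: lt_trans (proj2 (cP k)) _.
  by near: k; apply: cvgr_lt; [exact: cvg_harmonic|].
pose t k : R := harmonic k / (1 + a k).
have a1 k : 0 < 1 + a k by rewrite ltr_pwDl//; exact: (aP k).1.
have t0 k : 0 < t k by rewrite divr_gt0.
have tcvg : t k @[k --> \oo] --> 0.
  apply: (@squeeze_cvgr _ _ _ _ (cst 0) harmonic); last exact: cvg_harmonic.
    apply: nearW => k /=; rewrite (ltW (t0 k))/= ler_pdivrMr// ler_peMr ?(ltW (kpos k))//.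
    by rewrite lerDl; exact: (aP k).1.
  exact: cvg_cst.
exists (fun k => x + t k *: c k), t; split=> //.
- move=> k; have [ak [y Xy ->]] := aP k.
  have -> : x + t k *: (a k *: (y - x)) = (t k * a k) *: y + (1 - t k * a k) *: x.
    by apply/rowP => i; rewrite !mxE; ring.
  apply: cX => //; first by rewrite mulr_ge0// ltW.
  rewrite /t mulrAC ler_pdivrMr// mul1r.
  have : harmonic k * a k <= 1 * a k.
    by apply: ler_wpM2r => //; rewrite invf_le1// ler1n.
  lra.
- have : x + t k *: c k @[k --> \oo] --> x + 0 *: d.
    by apply: cvgD; [exact: cvg_cst|exact: cvgZ].
  by rewrite scale0r addr0.
- have -> : (fun k => (t k)^-1 *: (x + t k *: c k - x)) = c; last exact: ccvg.
  apply/funext => k; rewrite addrAC subrr add0r scalerA mulVf ?scale1r//.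
  by rewrite gt_eqF.
Unshelve. all: by end_near. Qed.

(** Bipolar theorem for the cone of feasible directions: a vector separating d
    from the closure of that cone is, up to sign, a normal vector at x. *)
Lemma polar_tangent_cone X x d : convex_set X -> X x ->
  (forall s, normal_cone X x s -> dot s d <= 0) -> tangent_cone X x d.
Proof.
move=> cX Xx polar; apply: closure_feasible_tangent_cone => //.
set C := cone _.
have C0 : C 0.
  by exists 0 => //=; exists 0; rewrite ?scale0r//; exists x; rewrite ?subrr.
have ccC : convex_cone C.
  apply: cone_convex_cone.
  have -> : [set y - x | y in X] = mink_sub X [set x].
    apply/seteqP; split=> z [y Xy]; first by move=> <-; exists y => //; exists x.
    by move=> [_ -> <-]; exists y.
  rewrite mink_subE; apply: mink_add_convex => //.
  by apply: convex_set_opp; exact: convex_set_set1.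
have [//|nCd] := pselect (closure C d).
have clC : C `<=` closure C := @subset_closure _ _.
have nC : closure C !=set0 by exists 0; exact: clC.
have [s s0 sC] := strict_separation (@closed_closure _ C)
  (convex_set_closure (convex_cone_convex ccC)) nC nCd.
have ss : 0 < dot s s by exact: dot_gt0.
have sd := sC 0 (clC _ C0); rewrite dot0r add0r in sd.
suff /polar : normal_cone X x s by lra.
move=> y Xy; rewrite leNgt; apply/negP => syx.
have [_ CZ] := ccC.
have Cy : C (y - x) by exists 1 => //=; exists (y - x); [exists y|rewrite scale1r].
(* On the ray through y - x the separating functional would reach its value
   at d. *)
have r0 : 0 <= dot s d / dot s (y - x) by rewrite divr_ge0// ltW//; lra.
have := sC _ (clC _ (CZ _ _ r0 Cy)); rewrite dotZr divfK ?gt_eqF//; lra.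
Qed.

(** Each index occurs once in the enumeration, so the summands can be collected
    into a single family w. *)
Lemma mink_bigP (m : nat) (P : pred 'I_m) (S : 'I_m -> set 'rV[R]_n) x :
  (\big[mink_add/[set 0]]_(i | P i) S i) x <->
  exists2 w : 'I_m -> 'rV[R]_n, forall i, P i -> S i (w i) &
    x = \sum_(i | P i) w i.
Proof.
have -> : (\big[mink_add/[set 0]]_(i | P i) S i) x <->
    exists2 w : 'I_m -> 'rV[R]_n,
      forall i, i \in index_enum 'I_m -> P i -> S i (w i) &
      x = \sum_(i | P i) w i; last first.
  split=> -[w Sw ->]; exists w => // i; last by move=> _; exact: Sw.
  by apply: Sw; rewrite mem_index_enum.
elim: (index_enum _) (index_enum_uniq 'I_m) x => [_ x|i r IH /= /andP[ir ur] x].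
  rewrite big_nil; split=> [->|[w _ ->]]; last by rewrite big_nil.
  by exists (fun=> 0) => //; rewrite big_nil.
rewrite big_cons; case: ifPn => Pi; last first.
  rewrite IH//; split=> -[w Sw ->]; exists w; rewrite ?big_cons ?(negPf Pi)// => j.
    rewrite inE => /predU1P[->|]; last exact: Sw.
    by rewrite (negPf Pi).
  by move=> jr; apply: Sw; rewrite inE jr orbT.
split.
  move=> [s Ss [_ /(IH ur)[w Sw ->] <-]].
  exists (fun j => if j == i then s else w j) => [j|].
    by rewrite inE; case: eqP => [->//|_ /= jr]; exact: Sw.
  rewrite big_cons Pi eqxx; congr (_ + _).
  rewrite big_seq_cond [RHS]big_seq_cond; apply: eq_bigr => j /andP[jr _].
  by case: eqP jr ir => // -> ->.
move=> [w Sw ->]; exists (w i); first by apply: Sw; rewrite ?inE ?eqxx.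
exists (\sum_(j <- r | P j) w j); last by rewrite big_cons Pi.
by apply/(IH ur); exists w => // j jr; apply: Sw; rewrite inE jr orbT.
Qed.

End cones.

(** * Alternatives and descent *)

Section first_order_conditions.
Context {R : realType} {n : nat}.
Implicit Types (A K X U : set 'rV[R]_n) (h phi : 'rV[R]_n -> R) (x d : 'rV[R]_n).

(** Separates 0 from A + K; a positive value on K could be scaled up to cancel
    the negative value on A. *)
Lemma alternative_compact_cone A K : compact A -> convex_set A -> A !=set0 ->
  closed K -> convex_cone K -> K 0 -> ~ mink_add A K 0 ->
  exists d, [/\ d != 0, forall a, A a -> dot d a < 0 &
                forall k, K k -> dot d k <= 0].
Proof.
move=> kA cA [a0 Aa0] clK ccK K0 nAK.
have AK0 : mink_add A K !=set0 by exists (a0 + 0), a0 => //; exists 0.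
have [d d0 dAK] := strict_separation (closed_mink_add kA clK)
  (mink_add_convex cA (convex_cone_convex ccK)) AK0 nAK.
have dd : 0 < dot d d by exact: dot_gt0.
have dak a k : A a -> K k -> dot d a + dot d k < 0.
  move=> Aa Kk; have : mink_add A K (a + k) by exists a => //; exists k.
  by move=> /dAK; rewrite dotDr dot0r; lra.
exists d; split=> // [a Aa|k Kk].
  by have := dak _ _ Aa K0; rewrite dot0r addr0.
rewrite leNgt; apply/negP => dk; have [_ KZ] := ccK.
have da0 : dot d a0 < 0 by have := dak _ _ Aa0 K0; rewrite dot0r addr0.
have r0 : 0 <= - dot d a0 / dot d k by rewrite divr_ge0 ?oppr_ge0 ?ltW.
have := dak _ _ Aa0 (KZ _ _ r0 Kk).
by rewrite dotZr divfK ?gt_eqF// subrr ltxx.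
Qed.

Section along_a_sequence.
Variables (phi : 'rV[R]_n -> R) (x d : 'rV[R]_n) (c : R).
Variables (y : nat -> 'rV[R]_n) (t : nat -> R).
Hypotheses (phic : upper_slope phi x d c) (t0 : forall k, 0 < t k).
Hypotheses (tcvg : t k @[k --> \oo] --> 0).
Hypotheses (dcvg : (t k)^-1 *: (y k - x) @[k --> \oo] --> d).

Lemma upper_slope_decrease : c < 0 -> \forall k \near \oo, phi (y k) < phi x.
Proof.
move=> c0; have e0 : 0 < - c / 2 by lra.
apply: filterS (upper_slope_seq phic t0 tcvg dcvg e0) => k /le_lt_trans; apply.
rewrite gtrDl pmulr_rlt0//; lra.
Qed.

Lemma upper_slope_usc (b : R) : phi x < b -> \forall k \near \oo, phi (y k) < b.
Proof.
move=> xb; near=> k.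
have : phi (y k) <= phi x + t k * (c + 1).
  by near: k; exact: (upper_slope_seq phic t0 tcvg dcvg).
suff : t k * (c + 1) < b - phi x by lra.
near: k; have lim0 : t k * (c + 1) @[k --> \oo] --> 0 * (c + 1).
  by apply: cvgM tcvg _; exact: cvg_cst.
by apply: cvgr_lt; [exact: lim0|rewrite mul0r subr_gt0].
Unshelve. all: by end_near. Qed.

End along_a_sequence.

(** Along a sequence realizing the tangent direction, constraints inactive at x
    stay negative by semicontinuity and active ones become negative by their
    slope, so a negative slope of the objective contradicts minimality. *)
Lemma no_feasible_descent (m : nat) X phi0 (phi : 'I_m -> 'rV[R]_n -> R) x d c0
    (c : 'I_m -> R) :
  local_minimizer [set y | X y /\ forall i, phi i y <= 0] phi0 x ->
  tangent_cone X x d -> upper_slope phi0 x d c0 ->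
  (forall i, upper_slope (phi i) x d (c i)) ->
  (forall i, phi i x = 0 -> c i < 0) -> 0 <= c0.
Proof.
move=> [[Xx phi_le0] xmin] [y [t [Xy t0 ycvg tcvg dcvg]]] slope0 slope neg.
rewrite leNgt; apply/negP => c00.
have dec := upper_slope_decrease slope0 t0 tcvg dcvg c00.
have feas : \forall k \near \oo, forall i, phi i (y k) <= 0.
  apply: filter_forall => i; have [phi0i|phiN] := eqVneq (phi i x) 0.
    have := upper_slope_decrease (slope i) t0 tcvg dcvg (neg i phi0i).
    by apply: filterS => k; rewrite phi0i; exact: ltW.
  have lt0 : phi i x < 0 by rewrite lt_neqAle phiN phi_le0.
  by apply: filterS (upper_slope_usc (slope i) t0 tcvg dcvg lt0) => k; exact: ltW.
have near_min := ycvg _ xmin.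
near \oo => k.
have : phi0 (y k) < phi0 x by near: k.
suff : phi0 x <= phi0 (y k) by lra.
have ymin : [set y | X y /\ forall i, phi i y <= 0] (y k) ->
  phi0 x <= phi0 (y k) by near: k.
by apply: ymin; split=> //; near: k.
Unshelve. all: by end_near. Qed.

Lemma near0_combination_lt0 (a b : R) : a <= 0 -> (a = 0 -> b < 0) ->
  \forall e \near 0^'+, a + e * b < 0.
Proof.
rewrite le_eqVlt => /predU1P[-> /(_ erefl) b0|a0 _].
  near=> e; have e0 : 0 < e by [].
  by rewrite add0r pmulr_rlt0.
have B0 : 0 < `|b| + 1 by rewrite ltr_wpDl.
near=> e; have e0 : 0 < e by [].
have : e < - a / (`|b| + 1).
  by near: e; apply: nbhs_right_lt; rewrite divr_gt0// oppr_gt0.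
rewrite ltr_pdivlMr// => eb.
have := ler_wpM2l (ltW e0) (ler_norm b); lra.
Unshelve. all: by end_near. Qed.

End first_order_conditions.

(** * Subdifferentials of differences and multipliers *)

Section dc_subdifferential.
Context {R : realType} {n : nat}.
Implicit Types (A B : set 'rV[R]_n) (a s r : 'rV[R]_n).

Lemma compact_mink_add A B : compact A -> compact B -> compact (mink_add A B).
Proof.
move=> cA cB; apply: bounded_closed_compact; last first.
  by apply: closed_mink_add => //; apply: compact_closed.
have [M [_ AM]] := compact_bounded cA; have [N [_ BN]] := compact_bounded cB.
exists (M + 1 + (N + 1)); split=> [|L ltL _ [a Aa [b Bb <-]]].
  by rewrite num_real.
apply: le_trans (ltW ltL); apply: le_trans (ler_normD _ _) _.
by apply: lerD; [apply: AM|apply: BN]; rewrite ?ltrDl.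
Qed.

Variables (U : set 'rV[R]_n) (x : 'rV[R]_n).
Hypotheses (oU : open U) (Ux : U x).
Variables (a : 'rV[R]_n) (p u : 'rV[R]_n -> R).
Hypotheses (cp : convex_function U p) (cu : convex_function U u).

Let D : set 'rV[R]_n := ([set a] + subdiff U p x - subdiff U u x)%mink.

Lemma dc_subdiff_mem s r :
  subdiff U p x s -> subdiff U u x r -> D (a + s - r).
Proof. by move=> ps ur; exists (a + s); [exists a => //; exists s|exists r]. Qed.

Lemma dc_subdiff_nonempty : D !=set0.
Proof.
have [s ps] := subdiff_nonempty oU cp Ux.
have [r ur] := subdiff_nonempty oU cu Ux.
by exists (a + s - r); exact: dc_subdiff_mem.
Qed.

Lemma dc_subdiff_convex : convex_set D.
Proof.
rewrite /D mink_subE; apply: mink_add_convex.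
  by apply: mink_add_convex; [exact: convex_set_set1|exact: subdiff_convex].
by apply: convex_set_opp; exact: subdiff_convex.
Qed.

Lemma dc_subdiff_compact : compact D.
Proof.
rewrite /D mink_subE; apply: compact_mink_add.
  by apply: compact_mink_add; [exact: compact_set1|exact: subdiff_compact].
by apply: compact_opp; exact: subdiff_compact.
Qed.

(** The infimum is a real-valued [inf], which is meaningful only because the
    derivative along - d bounds the set below. *)
Lemma subdiff_inf_le r d :
  subdiff U u x r -> inf [set dot s d | s in subdiff U u x] <= dot r d.
Proof.
move=> ur; apply: ge_inf; last by exists r.
exists (- dir_deriv u x (- d)) => _ [s us <-].
have := (subdiffP oU cu Ux s).1 us (- d); rewrite dotNr; lra.
Qed.

End dc_subdifferential.

Section multipliers.
Context {R : realType} {n m : nat}.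
Implicit Types (S : 'I_m -> set 'rV[R]_n) (P : pred 'I_m).

Lemma mink_sum_cone_convex_cone P S : (forall i, convex_set (S i)) ->
  convex_cone (\big[mink_add/[set 0]]_(i | P i) cone (S i)).
Proof.
move=> cS; apply: (big_ind (fun K => convex_cone K)) => [|A B|i _].
- by split=> [v w -> ->|t w _ ->]; rewrite /= ?addr0 ?scaler0.
- exact: mink_add_convex_cone.
- exact: cone_convex_cone.
Qed.

Lemma cone0 (A : set 'rV[R]_n) : A !=set0 -> cone A 0.
Proof. by move=> [a Aa]; exists 0 => //=; exists a; rewrite ?scale0r. Qed.

Lemma cone_sub (A : set 'rV[R]_n) : A `<=` cone A.
Proof. by move=> a Aa; exists 1 => //=; exists a; rewrite ?scale1r. Qed.

Lemma mink_sum_cone0 P S : (forall i, S i !=set0) ->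
  (\big[mink_add/[set 0]]_(i | P i) cone (S i)) 0.
Proof.
by move=> S0; apply/mink_bigP; exists (fun=> 0) => [i _|]; [exact: cone0|rewrite big1].
Qed.

Lemma mink_sum_cone_sub P S i : (forall i, S i !=set0) -> P i ->
  S i `<=` \big[mink_add/[set 0]]_(i | P i) cone (S i).
Proof.
move=> S0 Pi s Ss; apply/mink_bigP.
exists (fun j => if j == i then s else 0) => [j _|].
  by case: eqP => [->|_]; [exact: cone_sub|exact: cone0].
by rewrite (bigD1 i)//= eqxx big1 ?addr0// => j /andP[_ /negPf->].
Qed.

(** Indices outside P get the multiplier 0; the scaled set 0 *: S i is then {0}
    only because S i is nonempty. *)
Lemma mink_sum_cone_multipliers P S k : (forall i, S i !=set0) ->
  (\big[mink_add/[set 0]]_(i | P i) cone (S i)) k ->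
  exists lambda : 'rV[R]_m, [/\ forall i, 0 <= lambda 0 i,
    forall i, ~~ P i -> lambda 0 i = 0 &
    (\sum_(i < m) lambda 0 i *: S i)%mink k].
Proof.
move=> S0 /mink_bigP[w Sw ->].
have /choice[t tP] : forall i, exists t : R, [/\ 0 <= t, ~~ P i -> t = 0 &
    mink_scale t (S i) (if P i then w i else 0)].
  move=> i; case: ifPn => [/Sw[t /= t0 [s Ss <-]]|_].
    by exists t; split=> //; exists s.
  by have [s Ss] := S0 i; exists 0; split=> //; exists s; rewrite ?scale0r.
exists (\row_i t i); split=> [i|i|]; rewrite ?mxE; try by have [] := tP i.
apply/mink_bigP; exists (fun i => if P i then w i else 0) => [i _|].
  by rewrite mxE; have [] := tP i.
by rewrite big_mkcond.
Qed.

End multipliers.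

(** * Necessity of the KKT conditions *)

Theorem theorem2p1 (R : realType) (n m : nat) (X U : set 'rV[R]_n)
    (f p u : 'rV[R]_n -> R) (g q v : 'I_m -> 'rV[R]_n -> R)
    (X_nonempty : X !=set0) (X_closed : closed X) (X_convex : convex_set X)
    (U_open : open U) (U_convex : convex_set U) (X_sub_U : X `<=` U)
    (f_diff : forall x, X x -> differentiable f x)
    (g_diff : forall i x, X x -> differentiable (g i) x)
    (p_convex : convex_function U p) (u_convex : convex_function U u)
    (q_convex : forall i, convex_function U (q i))
    (v_convex : forall i, convex_function U (v i))
    (f_lip : lipschitz_gradient X f)
    (g_lip : forall i, lipschitz_gradient X (g i))
    (xs : 'rV[R]_n)
    (xs_min : local_minimizer (feasible X g q v)
                (fun x => f x + p x - u x) xs)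
    (cone_closed :
      closed (\sum_(i in active g q v xs)
                 cone (constraint_subdiff U g q v i xs)
              + normal_cone X xs)%mink)
    (mfcq : exists2 d, tangent_cone X xs d &
      forall i, active_tangent X g q v xs i ->
        dir_deriv (g i) xs d + dir_deriv (q i) xs d
          - inf [set dot s d | s in subdiff U (v i) xs] < 0) :
  exists lambda : 'rV[R]_m,
    ([set gradient f xs] + subdiff U p xs - subdiff U u xs
      + \sum_(i < m) lambda 0 i *: constraint_subdiff U g q v i xs
      + normal_cone X xs)%mink 0
    /\ forall i, 0 <= lambda 0 i /\
         lambda 0 i * (g i xs + q i xs - v i xs) = 0.
Proof.
pose C i := constraint_subdiff U g q v i xs.
pose A := ([set gradient f xs] + subdiff U p xs - subdiff U u xs)%mink.
pose K := (\sum_(i in active g q v xs) cone (C i) + normal_cone X xs)%mink.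
have [[Xx _] _] := xs_min.
have Ux : U xs by exact: X_sub_U.
have C0 i : C i !=set0 by apply: dc_subdiff_nonempty.
have N0 : normal_cone X xs 0 by move=> y _; rewrite dot0l.
have [[a Aa [_ [b sb [nu Nnu <-]] abnu]]|nAK] := pselect ((A + K)%mink 0).
  have [lambda [lambda0 lambdaN lambdab]] := mink_sum_cone_multipliers C0 sb.
  exists lambda; split.
    exists (a + b); first by exists a => //; exists b.
    by exists nu => //; rewrite -addrA.
  move=> i; split=> //; have [/set_mem ->|/lambdaN ->] :=
    boolP (i \in active g q v xs); by rewrite ?mulr0 ?mul0r.
exfalso.
have ccK : convex_cone K.
  apply: mink_add_convex_cone; last exact: normal_cone_convex_cone.
  by apply: mink_sum_cone_convex_cone => i; apply: dc_subdiff_convex.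
have sum0 : (\sum_(i in active g q v xs) cone (C i))%mink 0.
  exact: mink_sum_cone0.
have K0 : K 0 by exists 0 => //; exists 0; rewrite ?addr0.
have kA : compact A by exact: dc_subdiff_compact.
have cA : convex_set A by exact: dc_subdiff_convex.
have A0 : A !=set0 by exact: dc_subdiff_nonempty.
have [d [d0 dA dK]] := alternative_compact_cone kA cA A0 cone_closed ccK K0 nAK.
have dN s : normal_cone X xs s -> dot s d <= 0.
  by move=> Ns; rewrite dotC; apply: dK; exists 0 => //; exists s; rewrite ?add0r.
have dC i c : active g q v xs i -> C i c -> dot c d <= 0.
  move=> act Cc; rewrite dotC; apply: dK; exists c; last by exists 0; rewrite ?addr0.
  by apply: (mink_sum_cone_sub C0) Cc; rewrite mem_set.
have Td : tangent_cone X xs d by exact: polar_tangent_cone.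
have [dbar Tdbar mfcq_neg] := mfcq.
have [sp psp spd] := subdiff_dir_deriv U_open p_convex Ux d.
have [su usu] := subdiff_nonempty U_open u_convex Ux.
(* Subgradients of the v i that are exact along d: replacing v i by its
   linearization then loses nothing in that direction. *)
have /choice[sv svP] : forall i, exists s, subdiff U (v i) xs s /\
    dot s d = dir_deriv (v i) xs d.
  by move=> i; have [s vs sd] := subdiff_dir_deriv U_open (v_convex i) Ux d; exists s.
have qD i := dir_deriv_sublinear U_open (q_convex i) Ux.
have pD := dir_deriv_sublinear U_open p_convex Ux.
(* Upper slopes of the objective and of the constraints, sublinear in w. *)
pose c0 w := dot (gradient f xs) w + dir_deriv p xs w - dot su w.
pose c i w := dot (gradient (g i) xs) w + dir_deriv (q i) xs w - dot (sv i) w.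
have c0d : c0 d < 0.
  have := dA _ (dc_subdiff_mem (gradient f xs) psp usu).
  by rewrite dotC dotBl dotDl spd.
have cd i : active g q v xs i -> c i d <= 0.
  move=> act; have [sq qsq sqd] := subdiff_dir_deriv U_open (q_convex i) Ux d.
  have := dC i _ act (dc_subdiff_mem (gradient (g i) xs) qsq (svP i).1).
  by rewrite dotBl dotDl sqd.
(* The constraint qualification, which involves all subgradients of v i, is
   used for the chosen one only. *)
have cdbar i : active g q v xs i -> c i d = 0 -> c i dbar < 0.
  move=> act cid0.
  have : active_tangent X g q v xs i.
    split=> //; exists d; split=> //.
    by rewrite (dir_deriv_differentiable _ (g_diff i xs Xx)) -(svP i).2.
  move=> /mfcq_neg; rewrite (dir_deriv_differentiable _ (g_diff i xs Xx)).
  have := subdiff_inf_le U_open Ux (v_convex i) dbar (svP i).1.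
  rewrite /c; lra.
have c0_lt0 : \forall e \near 0^'+, c0 d + e * c0 dbar < 0.
  by apply: near0_combination_lt0; [exact: ltW|lra].
have c_lt0 : \forall e \near 0^'+, forall i, active g q v xs i ->
    c i d + e * c i dbar < 0.
  apply: filter_forall => i.
  have [act|nact] := pselect (active g q v xs i); last exact: nearW.
  have := near0_combination_lt0 (cd i act) (cdbar i act).
  by apply: filterS => e.
(* One e serves all constraints, finite in number, and the objective. *)
near (0 : R)^'+ => e.
have e0 : 0 < e by [].
pose w := d + e *: dbar.
have Tw : tangent_cone X xs w.
  apply: polar_tangent_cone => // s Ns; rewrite dotDr dotZr.
  have := dN s Ns; have := tangent_cone_polar Tdbar Ns.
  by move=> /(ler_wpM2l (ltW e0)); rewrite mulr0; lra.
have c0w : c0 w < 0.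
  have : c0 d + e * c0 dbar < 0 by near: e.
  have [pDD pDZ] := pD; have := pDD d (e *: dbar); rewrite (pDZ _ _ (ltW e0)).
  by rewrite /c0 /w !dotDr !dotZr; lra.
have cw i : active g q v xs i -> c i w < 0.
  move=> act; have : c i d + e * c i dbar < 0 by move: i act; near: e.
  have [qDD qDZ] := qD i; have := qDD d (e *: dbar); rewrite (qDZ _ _ (ltW e0)).
  by rewrite /c /w !dotDr !dotZr; lra.
have slope0 : upper_slope (fun x => f x + p x - u x) xs w (c0 w).
  apply: (upper_slopeD (upper_slopeD _ _)).
  - by apply: upper_slope_differentiable; exact: f_diff.
  - exact: upper_slope_convex U_open U_convex p_convex Ux _.
  - exact: upper_slope_concave U_open U_convex u_convex Ux _ _ usu.
have slope i : upper_slope (fun x => g i x + q i x - v i x) xs w (c i w).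
  apply: (upper_slopeD (upper_slopeD _ _)).
  - by apply: upper_slope_differentiable; exact: g_diff.
  - exact: upper_slope_convex U_open U_convex (q_convex i) Ux _.
  - exact: upper_slope_concave U_open U_convex (v_convex i) Ux _ _ (svP i).1.
have := no_feasible_descent xs_min Tw slope0 slope cw.
by rewrite leNgt c0w.
Unshelve. all: by end_near. Qed.
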